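(* Let $c$ be an acyclic NNF constraint, let $K$ be the set of all refinement variables, and let $c'=\mathrm{elim}(K,c)$. Then: (1) $\mathrm{kvars}(c')=\emptyset$, i.e. $c'$ is a verification condition; and (2) $c'$ is satisfiable if and only if $c$ is satisfiable.
   Context: **Constraints.** Refinements $r$ (forming a set $R$) are formulas drawn from a decidable refinement logic, e.g. the quantifier-free theory of linear arithmetic and uninterpreted functions. $K$ is the set of refinement variables; each $\kappa\in K$ stands for an unknown relation and has a list $\mathrm{args}(\kappa)=\bar x$ of typed parameters; it is always applied to as many variables as it has parameters. Predicates: $p ::= r\mid\kappa(\bar y)\mid p_1\wedge p_2$. NNF constraints: $c ::= p\mid c_1\wedge c_2\mid\forall x{:}b.\,p\Rightarrow c$, with $b$ a base type. $\mathrm{kvars}(c)$ is the set of refinement variables occurring in $c$; $\kappa\in c$ means $\kappa$ occurs in $c$. A verification condition is a constraint $c$ with $\mathrm{kvars}(c)=\emptyset$. **Assignments and satisfaction.** An assignment $\sigma$ maps refinement variables to refinements; it is partial if its range is predicates (possibly containing refinement variables). Refinement variables outside its domain are left unchanged. $\sigma(\kappa(\bar y))=\sigma(\kappa)[\bar y/\bar x]$ with $\bar x=\mathrm{args}(\kappa)$, $\sigma(r)=r$, and $\sigma$ extends homomorphically to predicates and constraints. A constraint without refinement variables is well-formed under an environment $\Gamma$ of typed variables if: for a refinement $r$, $r$ has type bool under $\Gamma$ (unrefined typing); for $c_1\wedge c_2$, both conjuncts are well-formed under $\Gamma$; for $\forall x{:}b.\,r\Rightarrow c$, both $r$ and $c$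 are well-formed under $\Gamma,x{:}b$. A constraint containing a refinement variable is not well-formed. $\sigma$ satisfies $c$ if $\sigma(c)$ is a verification condition that is well-formed under the empty environment and logically valid. $c$ is satisfiable if some assignment satisfies it. **Dependencies.** $\mathrm{flatten}(\mathit{true})=\emptyset$; $\mathrm{flatten}(p)=\{p\}$ for other predicates; $\mathrm{flatten}(c\wedge c')=\mathrm{flatten}(c)\cup\mathrm{flatten}(c')$; $\mathrm{flatten}(\forall x{:}b.\,p\Rightarrow c)=\{\forall x{:}b.\,p\Rightarrow c'\mid c'\in\mathrm{flatten}(c)\}$. For a flat constraint $\forall x_1{:}b_1.\,p_1\Rightarrow\dots\Rightarrow\forall x_n{:}b_n.\,p_n\Rightarrow p$ the head is $p$ and the body is $\{p_1,\dots,p_n\}$. $\mathrm{dep}(c)$ is the set of pairs $(\kappa,\kappa')$ such that some member of $\mathrm{flatten}(c)$ has $\kappa$ in its body and $\kappa'$ in its head. $c$ is acyclic if the directed graph $\mathrm{dep}(c)$ has no cycle (self-loops count as cycles). **Scope.** $\mathrm{scope}(\kappa,c_1\wedge c_2)$ is $\mathrm{scope}(\kappa,c_1)$ if $\kappa\in c_1,\kappa\notin c_2$, and $\mathrm{scope}(\kappa,c_2)$ if $\kappa\notin c_1,\kappa\in c_2$; $\mathrm{scope}(\kappa,\forall x{:}b.\,p\Rightarrow c')=\forall x{:}b.\,p\Rightarrow\mathrm{scope}(\kappa,c')$ if $\kappa\notin p$; in all other cases $\mathrm{scope}(\kappa,c)=c$. **Solutions.** $\mathrm{sol}(\kappa,c)$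 is the following predicate (here also built with $\vee$ and $\exists$): $\mathrm{sol}(\kappa,c_1\wedge c_2)=\mathrm{sol}(\kappa,c_1)\vee\mathrm{sol}(\kappa,c_2)$; $\mathrm{sol}(\kappa,\forall x{:}b.\,p\Rightarrow c)=\exists x{:}b.\,(p\wedge\mathrm{sol}(\kappa,c))$; $\mathrm{sol}(\kappa,\kappa(\bar y))=\bigwedge_i x_i=y_i$ where $\bar x=\mathrm{args}(\kappa)$; $\mathrm{sol}(\kappa,p)=\mathit{false}$ for predicates $p$ not covered by the previous clauses. The strongest scoped solution is $\hat\sigma_{c,\kappa}=[\kappa\mapsto\lambda\bar x.\,\mathrm{sol}(\kappa,c'')]$, where $\bar x=\mathrm{args}(\kappa)$ and $\mathrm{scope}(\kappa,c)$ is $\forall x_1{:}b_1.\,p_1\Rightarrow\dots\Rightarrow\forall x_n{:}b_n.\,p_n\Rightarrow c''$ with $\kappa\notin p_i$ for all $i$. **Elimination.** $\mathrm{elim}_\sigma(c_1\wedge c_2)=\mathrm{elim}_\sigma(c_1)\wedge\mathrm{elim}_\sigma(c_2)$; $\mathrm{elim}_\sigma(\forall x{:}b.\,p\Rightarrow c)=\forall x{:}b.\,\sigma(p)\Rightarrow\mathrm{elim}_\sigma(c)$; $\mathrm{elim}_\sigma(\kappa(\bar y))=\mathit{true}$ if $\kappa\in\mathrm{dom}(\sigma)$; $\mathrm{elim}_\sigma(p)=p$ for predicates not covered by the previous clauses. $\mathrm{elim1}(\kappa,c)=\mathrm{elim}_{\hat\sigma_{c,\kappa}}(c)$. Finally $\mathrm{elim}([],c)=c$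 and $\mathrm{elim}(\kappa:\bar\kappa,c)=\mathrm{elim}(\bar\kappa,\mathrm{elim1}(\kappa,c))$; a set of refinement variables is eliminated by listing its elements one after the other, with no particular order prescribed.
   Formalization: (2) is proved for listings putting each κ after those it depends on (it fails for some other orders); binders distinct from each other and from parameters; κ applied to in-scope variables of its parameter types; refinements closed under ∧,∨,∃,=; sol simplifies false, else (1) fails. *)

(* Defs.v *)
From mathcomp Require Import all_boot.

Set Implicit Arguments.
Unset Strict Implicit.
Unset Printing Implicit Defensive.

Definition var := nat.

Definition fresh (xs : seq var) : var := (foldr maxn 0 xs).+1.

Definition upd (A : Type) (f : var -> A) (x : var) (a : A) : var -> A :=
  fun z => if z == x then a else f z.

(* A refinement logic: [atom] is its set of formulas, typed under environments
   ([None]: not in the environment) and interpreted in a class of models, so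
   that function symbols may be uninterpreted. [value m] collects the elements
   of all base types, [inbase] carving out each of them. The laws say that
   typing and satisfaction depend on the free variables only and commute with
   renaming of variables. *)
Record logic := Logic {
  base : Type;
  atom : Type;
  atom_fv : atom -> seq var;
  atom_ren : (var -> var) -> atom -> atom;
  atom_wt : (var -> option base) -> atom -> Prop;
  model : Type;
  value : model -> Type;
  value_inhabited : forall m, inhabited (value m);
  inbase : forall m, base -> value m -> Prop;
  atom_sat : forall m, (var -> value m) -> atom -> Prop;
  atom_wt_fv : forall G a, atom_wt G a ->
    forall x, x \in atom_fv a -> G x <> None;
  atom_wt_ext : forall G G' a, (forall x, x \in atom_fv a -> G x = G' x) ->
    atom_wt G a -> atom_wt G' a;
  atom_wt_ren : forall G f a, atom_wt G (atom_ren f a) <-> atom_wt (G \o f) a;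
  atom_sat_ext : forall m (e e' : var -> value m) a,
    (forall x, x \in atom_fv a -> e x = e' x) -> atom_sat e a -> atom_sat e' a;
  atom_sat_ren : forall m (e : var -> value m) f a,
    atom_sat e (atom_ren f a) <-> atom_sat (e \o f) a
}.

Arguments inbase {l} m b v.
Arguments atom_sat {l} m e a.

Section Constraints.

Variables (L : logic) (K : finType) (params : K -> seq (var * base L)).

(* The predicates needed by solutions, hence including disjunctions, existentials
   and equalities between variables. The refinements are the predicates without
   refinement variables, see [is_refinement]; the predicates of source
   constraints are singled out by [nnf_pred]. *)
Inductive predicate :=
| PAtom (a : atom L)
| PTrue
| PFalse
| PEq (x y : var)
| PKVar (k : K) (ys : seq var)
| PAnd (p q : predicate)
| POr (p q : predicate)
| PEx (x : var) (b : base L) (p : predicate).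

Inductive constraint :=
| CPred (p : predicate)
| CAnd (c1 c2 : constraint)
| CAll (x : var) (b : base L) (p : predicate) (c : constraint).

Fixpoint pkvars (p : predicate) : seq K :=
  match p with
  | PKVar k _ => [:: k]
  | PAnd p q | POr p q => pkvars p ++ pkvars q
  | PEx _ _ p => pkvars p
  | _ => [::]
  end.

Fixpoint kvars (c : constraint) : seq K :=
  match c with
  | CPred p => pkvars p
  | CAnd c1 c2 => kvars c1 ++ kvars c2
  | CAll _ _ p c => pkvars p ++ kvars c
  end.

Definition is_refinement (p : predicate) : bool := pkvars p == [::].

(* p ::= r | k(ys) | p /\ p *)
Fixpoint nnf_pred (p : predicate) : bool :=
  match p with
  | PKVar _ _ => true
  | PAnd p q => nnf_pred p && nnf_pred q
  | r => is_refinement r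
  end.

Fixpoint nnf (c : constraint) : bool :=
  match c with
  | CPred p => nnf_pred p
  | CAnd c1 c2 => nnf c1 && nnf c2
  | CAll _ _ p c => nnf_pred p && nnf c
  end.

Fixpoint pfv (p : predicate) : seq var :=
  match p with
  | PAtom a => atom_fv a
  | PTrue | PFalse => [::]
  | PEq x y => [:: x; y]
  | PKVar _ ys => ys
  | PAnd p q | POr p q => pfv p ++ pfv q
  | PEx x _ p => [seq z <- pfv p | z != x]
  end.

(* Capture-avoiding: every bound variable is renamed apart from the image. *)
Fixpoint psubst (f : var -> var) (p : predicate) : predicate :=
  match p with
  | PAtom a => PAtom (atom_ren f a)
  | PTrue => PTrue
  | PFalse => PFalse
  | PEq x y => PEq (f x) (f y)
  | PKVar k ys => PKVar k (map f ys)
  | PAnd p q => PAnd (psubst f p) (psubst f q)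
  | POr p q => POr (psubst f p) (psubst f q)
  | PEx x b p =>
      let x' := fresh [seq f z | z <- pfv p & z != x] in
      PEx x' b (psubst (upd f x x') p)
  end.

(* ys / args(k) *)
Definition inst (k : K) (ys : seq var) : var -> var :=
  let xs := unzip1 (params k) in
  fun z => if z \in xs then nth z ys (index z xs) else z.

(* The solution of [k] is open in the variables of [params k]. It may mention
   further variables: applying an assignment goes under the binders of a
   constraint without renaming them, so these are bound wherever [k] occurs. *)
Definition assignment := K -> option predicate.

Definition total_assignment (s : assignment) : Prop :=
  forall k p, s k = Some p -> is_refinement p.

Fixpoint papply (s : assignment) (p : predicate) : predicate :=
  match p with
  | PKVar k ys => if s k is Some q then psubst (inst k ys) q else p
  | PAnd p q => PAnd (papply s p) (papply s q)
  | POr p q => POr (papply s p) (papply s q)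
  | PEx x b p => PEx x b (papply s p)
  | r => r
  end.

Fixpoint capply (s : assignment) (c : constraint) : constraint :=
  match c with
  | CPred p => CPred (papply s p)
  | CAnd c1 c2 => CAnd (capply s c1) (capply s c2)
  | CAll x b p c => CAll x b (papply s p) (capply s c)
  end.

Definition env := var -> option (base L).

Definition empty_env : env := fun _ => None.

Fixpoint pwf (G : env) (p : predicate) : Prop :=
  match p with
  | PAtom a => atom_wt G a
  | PTrue | PFalse => True
  | PEq x y => exists b, G x = Some b /\ G y = Some b
  | PKVar _ _ => False
  | PAnd p q | POr p q => pwf G p /\ pwf G q
  | PEx x b p => pwf (upd G x (Some b)) p
  end.

Fixpoint cwf (G : env) (c : constraint) : Prop :=
  match c with
  | CPred p => pwf G p
  | CAnd c1 c2 => cwf G c1 /\ cwf G c2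
  | CAll x b p c =>
      pwf (upd G x (Some b)) p /\ cwf (upd G x (Some b)) c
  end.

(* The value at [PKVar] is immaterial: only verification conditions are
   interpreted. *)
Fixpoint psat (m : model L) (e : var -> value m) (p : predicate) : Prop :=
  match p with
  | PAtom a => atom_sat m e a
  | PTrue => True
  | PFalse => False
  | PEq x y => e x = e y
  | PKVar _ _ => False
  | PAnd p q => psat e p /\ psat e q
  | POr p q => psat e p \/ psat e q
  | PEx x b p => exists v, inbase m b v /\ psat (upd e x v) p
  end.

Fixpoint csat (m : model L) (e : var -> value m) (c : constraint) : Prop :=
  match c with
  | CPred p => psat e p
  | CAnd c1 c2 => csat e c1 /\ csat e c2
  | CAll x b p c =>
      forall v, inbase m b v -> psat (upd e x v) p -> csat (upd e x v) c
  end.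

Definition valid (c : constraint) : Prop :=
  forall (m : model L) (e : var -> value m), csat e c.

Definition is_vc (c : constraint) : Prop := kvars c = [::].

Definition satisfies (s : assignment) (c : constraint) : Prop :=
  [/\ total_assignment s, is_vc (capply s c), cwf empty_env (capply s c)
    & valid (capply s c)].

Definition satisfiable (c : constraint) : Prop := exists s, satisfies s c.

(* A flat constraint: its binders with their hypotheses, and its head. *)
Definition flat := (seq (var * base L * predicate) * predicate)%type.

Fixpoint flatten (c : constraint) : seq flat :=
  match c with
  | CPred PTrue => [::]
  | CPred p => [:: ([::], p)]
  | CAnd c1 c2 => flatten c1 ++ flatten c2
  | CAll x b p c => [seq ((x, b, p) :: f.1, f.2) | f <- flatten c]
  end.

Definition head_kvars (f : flat) : seq K := pkvars f.2.

Definition body_kvars (f : flat) : seq K :=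
  seq.flatten [seq pkvars h.2 | h <- f.1].

Definition dep (c : constraint) : rel K :=
  fun k k' => has (fun f => (k \in body_kvars f) && (k' \in head_kvars f))
                  (flatten c).

(* [cycle] holds of the empty sequence, whence the cons. *)
Definition acyclic (c : constraint) : Prop :=
  forall k (s : seq K), ~~ cycle (dep c) (k :: s).

(* A conjunction of predicates in head position is also a conjunction of
   constraints; [pscope], [psol] and [pelim] are [scope], [sol] and [elim_with]
   on such heads. *)
Fixpoint pscope (k : K) (p : predicate) : predicate :=
  match p with
  | PAnd p1 p2 =>
      if (k \in pkvars p1) && (k \notin pkvars p2) then pscope k p1
      else if (k \notin pkvars p1) && (k \in pkvars p2) then pscope k p2
      else p
  | _ => p
  end.

Fixpoint scope (k : K) (c : constraint) : constraint :=
  match c with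
  | CPred p => CPred (pscope k p)
  | CAnd c1 c2 =>
      if (k \in kvars c1) && (k \notin kvars c2) then scope k c1
      else if (k \notin kvars c1) && (k \in kvars c2) then scope k c2
      else c
  | CAll x b p c' => if k \notin pkvars p then CAll x b p (scope k c') else c
  end.

Fixpoint scope_matrix (k : K) (c : constraint) : constraint :=
  match c with
  | CAll _ _ p c' => if k \notin pkvars p then scope_matrix k c' else c
  | _ => c
  end.

(* The connectives of solutions, up to the laws false \/ p = p = p \/ false,
   p /\ false = false and (exists x, false) = false. Without them the solution
   of [k] for (forall x, true => k(x)) /\ (forall y, k(y) => r) would contain
   the vacuous disjunct (exists y, k(y) /\ false), in which [k] occurs. *)
Definition sol_or (p q : predicate) : predicate :=
  match p, q with
  | PFalse, _ => q
  | _, PFalse => p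
  | _, _ => POr p q
  end.

Definition sol_and (p q : predicate) : predicate :=
  if q is PFalse then PFalse else PAnd p q.

Definition sol_ex (x : var) (b : base L) (p : predicate) : predicate :=
  if p is PFalse then PFalse else PEx x b p.

Definition args_eq (k : K) (ys : seq var) : predicate :=
  foldr PAnd PTrue [seq PEq xy.1 xy.2 | xy <- zip (unzip1 (params k)) ys].

Fixpoint psol (k : K) (p : predicate) : predicate :=
  match p with
  | PAnd p q => sol_or (psol k p) (psol k q)
  | PKVar k' ys => if k' == k then args_eq k ys else PFalse
  | _ => PFalse
  end.

Fixpoint sol (k : K) (c : constraint) : predicate :=
  match c with
  | CPred p => psol k p
  | CAnd c1 c2 => sol_or (sol k c1) (sol k c2)
  | CAll x b p c => sol_ex x b (sol_and p (sol k c))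
  end.

Definition strongest_scoped (c : constraint) (k : K) : assignment :=
  fun k' => if k' == k then Some (sol k (scope_matrix k (scope k c))) else None.

Fixpoint pelim (s : assignment) (p : predicate) : predicate :=
  match p with
  | PAnd p q => PAnd (pelim s p) (pelim s q)
  | PKVar k _ => if s k is Some _ then PTrue else p
  | _ => p
  end.

Fixpoint elim_with (s : assignment) (c : constraint) : constraint :=
  match c with
  | CPred p => CPred (pelim s p)
  | CAnd c1 c2 => CAnd (elim_with s c1) (elim_with s c2)
  | CAll x b p c => CAll x b (papply s p) (elim_with s c)
  end.

Definition elim1 (k : K) (c : constraint) : constraint :=
  elim_with (strongest_scoped c k) c.

Fixpoint elim (ks : seq K) (c : constraint) : constraint :=
  if ks is k :: ks' then elim ks' (elim1 k c) else c.

(* Refinement variables are applied to variables in scope, with the number and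
   the types of their parameters. *)
Fixpoint pkapp (G : env) (p : predicate) : Prop :=
  match p with
  | PKVar k ys => map G ys = [seq Some xb.2 | xb <- params k]
  | PAnd p q | POr p q => pkapp G p /\ pkapp G q
  | PEx x b p => pkapp (upd G x (Some b)) p
  | _ => True
  end.

Fixpoint kapp (G : env) (c : constraint) : Prop :=
  match c with
  | CPred p => pkapp G p
  | CAnd c1 c2 => kapp G c1 /\ kapp G c2
  | CAll x b p c =>
      pkapp (upd G x (Some b)) p /\ kapp (upd G x (Some b)) c
  end.

Fixpoint binders (c : constraint) : seq var :=
  match c with
  | CPred _ => [::]
  | CAnd c1 c2 => binders c1 ++ binders c2
  | CAll x _ _ c => x :: binders c
  end.

(* The variable convention. Since assignments capture, it matters: e.g. with a
   nullary k, (forall x, x = a => k()) /\ (forall x, k() => x = a) would be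
   satisfied by k := (x = a) if the two binders could share their name. *)
Definition distinct_names (c : constraint) : Prop :=
  uniq (binders c) /\
  forall k, uniq (unzip1 (params k)) /\
    {in unzip1 (params k), forall x, x \notin binders c}.

(* Every refinement variable is listed after those it depends on. Otherwise the
   solution of k' may put an occurrence of some k under an existential copied
   from a binder of the constraint; [scope] does not see through it, so that k
   gets solved outside the scope of that binder, or loses it to a renaming. *)
Definition dependency_order (c : constraint) (ks : seq K) : Prop :=
  forall k k', dep c k k' -> index k ks < index k' ks.

End Constraints.

Arguments predicate : clear implicits.
Arguments constraint : clear implicits.
Arguments empty_env : clear implicits.

(* Main.v *)
(** Acyclicity yields a rank of the refinement variables that strictly increases
    along dependencies. The solution of [k] contains only variables of smaller
    rank than [k], hence eliminating [k] removes it for good and only creates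
    dependencies that compose two old ones: the rank remains valid.

    In a dependency order the solution of the eliminated [k] contains no
    refinement variable at all. If [s] satisfies the constraint after elimination,
    then [s] updated at [k] with the strongest solution satisfies the one before:
    the heads [k(ys)] hold by construction. Conversely, a satisfying [s] still
    satisfies the constraint after elimination, because the strongest solution
    implies [s k] and [k] occurs in hypotheses otherwise. The latter implication
    compares [s k] on different paths below the scope of [k]. It relies on the fact
    that [s k] can only mention its parameters and variables bound above this
    scope: [k] occurs on both sides of the conjunction where its scope ends, and
    these bind disjoint sets of variables. *)

From Stdlib Require Import Setoid.
Require Import Defs.
From mathcomp Require Import all_boot.

Set Implicit Arguments.
Unset Strict Implicit.
Unset Printing Implicit Defensive.

(** * Predicates: substitution, typing and satisfaction *)

Lemma fresh_notin (xs : seq var) : fresh xs \notin xs.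
Proof.
have le_max x : x \in xs -> x <= foldr maxn 0 xs.
  elim: xs => //= y xs IH; rewrite inE leq_max => /predU1P [-> | /IH ->].
    by rewrite leqnn.
  by rewrite orbT.
by apply/negP => /le_max; rewrite /fresh ltnn.
Qed.

Lemma cat_nilP (T : eqType) (s t : seq T) :
  (s ++ t == [::]) = (s == [::]) && (t == [::]).
Proof. by case: s. Qed.

Section Predicates.

Variables (L : logic) (K : finType) (params : K -> seq (var * base L)).

Implicit Types (p q : predicate L K) (c : constraint L K) (G : env L).
Implicit Types (s : assignment L K).

(** Disjunctions and existentials pass [nnf_pred] only as refinements, so they share one base case
    with the atoms. *)
Lemma nnf_pred_ind (P : predicate L K -> Prop) :
  (forall p, is_refinement p -> P p) ->
  (forall k ys, P (PKVar L k ys)) ->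
  (forall p q, P p -> P q -> P (PAnd p q)) ->
  forall p, nnf_pred p -> P p.
Proof.
move=> Pref Pkvar Pand; elim=> //=.
- by move=> a _; apply: Pref.
- by move=> _; apply: Pref.
- by move=> _; apply: Pref.
- by move=> x y _; apply: Pref.
- by move=> p IHp q IHq /andP [/IHp Pp /IHq Pq]; apply: Pand.
- by move=> p _ q _; apply: Pref.
- by move=> x b p _; apply: Pref.
Qed.

Lemma nnf_refinement p : is_refinement p -> nnf_pred p.
Proof.
elim: p => //= p IHp q IHq; rewrite /is_refinement /= cat_nilP.
by case/andP => /IHp -> /IHq ->.
Qed.

Lemma pkvars_psubst f p : pkvars (psubst f p) = pkvars p.
Proof. by elim: p f => //= p IHp q IHq f; rewrite IHp IHq. Qed.

Lemma papply_refinement s p : is_refinement p -> papply params s p = p.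
Proof.
rewrite /is_refinement; elim: p => //=.
- by move=> p IHp q IHq; rewrite cat_nilP => /andP [/IHp -> /IHq ->].
- by move=> p IHp q IHq; rewrite cat_nilP => /andP [/IHp -> /IHq ->].
- by move=> x b p IHp /IHp ->.
Qed.

Lemma pelim_refinement s p : is_refinement p -> pelim s p = p.
Proof.
rewrite /is_refinement; elim: p => //= p IHp q IHq.
by rewrite cat_nilP => /andP [/IHp -> /IHq ->].
Qed.

Lemma pkapp_refinement G p : is_refinement p -> pkapp params G p.
Proof.
rewrite /is_refinement; elim: p G => //=.
- by move=> p IHp q IHq G; rewrite cat_nilP => /andP [/IHp ? /IHq ?].
- by move=> p IHp q IHq G; rewrite cat_nilP => /andP [/IHp ? /IHq ?].
- by move=> x b p IHp G /IHp.
Qed.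

Lemma pwf_refinement G p : pwf G p -> is_refinement p.
Proof.
rewrite /is_refinement; elim: p G => //=.
- by move=> p IHp q IHq G [/IHp /eqP -> /IHq /eqP ->].
- by move=> p IHp q IHq G [/IHp /eqP -> /IHq /eqP ->].
- by move=> x b p IHp G /IHp.
Qed.

Lemma pwf_fv G p x : pwf G p -> x \in pfv p -> G x <> None.
Proof.
elim: p G => //=.
- by move=> a G /atom_wt_fv; apply.
- move=> y z G [b [Gy Gz]]; rewrite !inE.
  by case/orP => /eqP ->; rewrite ?Gy ?Gz.
- by move=> p IHp q IHq G [wp wq]; rewrite mem_cat;
  case/orP => [/(IHp _ wp) | /(IHq _ wq)].
- by move=> p IHp q IHq G [wp wq]; rewrite mem_cat;
  case/orP => [/(IHp _ wp) | /(IHq _ wq)].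
- move=> y b p IHp G wp; rewrite mem_filter => /andP [/negPf xy xp].
  by have := IHp _ wp xp; rewrite /upd xy.
Qed.

Lemma pwf_ext G G' p :
  (forall x, x \in pfv p -> G x = G' x) -> pwf G p -> pwf G' p.
Proof.
elim: p G G' => //=.
- by move=> a G G' GG'; apply: atom_wt_ext.
- by move=> x y G G' GG' [b []]; rewrite !GG' ?inE ?eqxx ?orbT //; exists b.
- move=> p IHp q IHq G G' GG' [wp wq].
  by split; [apply: (IHp G) | apply: (IHq G)] => // x xp;
     apply: GG'; rewrite mem_cat xp ?orbT.
- move=> p IHp q IHq G G' GG' [wp wq].
  by split; [apply: (IHp G) | apply: (IHq G)] => // x xp;
     apply: GG'; rewrite mem_cat xp ?orbT.
- move=> y b p IHp G G' GG'; apply: IHp => x xp; rewrite /upd.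
  by case: eqP => // /eqP xy; apply: GG'; rewrite mem_filter xy.
Qed.

Lemma psat_ext m (e e' : var -> value m) p :
  (forall x, x \in pfv p -> e x = e' x) -> psat e p -> psat e' p.
Proof.
elim: p e e' => //=.
- by move=> a e e' ee'; apply: atom_sat_ext.
- by move=> x y e e' ee'; rewrite !ee' ?inE ?eqxx ?orbT.
- move=> p IHp q IHq e e' ee' [wp wq].
  by split; [apply: (IHp e) | apply: (IHq e)] => // x xp;
     apply: ee'; rewrite mem_cat xp ?orbT.
- move=> p IHp q IHq e e' ee' [wp | wq];
    [left; apply: (IHp e) | right; apply: (IHq e)] => // x xp;
    by apply: ee'; rewrite mem_cat xp ?orbT.
- move=> y b p IHp e e' ee' [v [bv pv]]; exists v; split=> //.
  apply: IHp pv => x xp; rewrite /upd.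
  by case: eqP => // /eqP xy; apply: ee'; rewrite mem_filter xy.
Qed.

(** The fresh name differs from the image under [f] of every other free variable, so updating it
    disturbs none of them. This is the binder case of both substitution lemmas. *)
Lemma upd_comp_fresh (A : Type) (u : var -> A) (f : var -> var) x a p z :
  z \in pfv p ->
  let x' := fresh [seq f z | z <- pfv p & z != x] in
  (upd u x' a \o upd f x x') z = upd (u \o f) x a z.
Proof.
move=> zp x'; rewrite /= /upd; case: (eqVneq z x) => [_ | zx]; first by rewrite eqxx.
case: eqP => // fz; have := fresh_notin [seq f z | z <- pfv p & z != x].
by rewrite -/x' -fz map_f // mem_filter zx.
Qed.

Lemma pwf_psubst G f p : pwf G (psubst f p) <-> pwf (G \o f) p.
Proof.
elim: p G f => //=.
- by move=> a G f; apply: atom_wt_ren.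
- by move=> p IHp q IHq G f; rewrite IHp IHq.
- by move=> p IHp q IHq G f; rewrite IHp IHq.
- move=> x b p IHp G f; rewrite IHp.
  by split; apply: pwf_ext => z zp; rewrite upd_comp_fresh.
Qed.

Lemma psat_psubst m (e : var -> value m) f p :
  psat e (psubst f p) <-> psat (e \o f) p.
Proof.
elim: p e f => //=.
- by move=> a e f; apply: atom_sat_ren.
- by move=> p IHp q IHq e f; rewrite IHp IHq.
- by move=> p IHp q IHq e f; rewrite IHp IHq.
- move=> x b p IHp e f.
  by split=> -[v [bv pv]]; exists v; split=> //; move: pv; rewrite IHp;
     apply: psat_ext => z zp; rewrite upd_comp_fresh.
Qed.

(** * Connectives of solutions *)

Lemma psat_sol_or m (e : var -> value m) p q :
  psat e (sol_or p q) <-> psat e p \/ psat e q.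
Proof. by case: p => /=; try tauto; case: q => //=; tauto. Qed.

Lemma psat_sol_and m (e : var -> value m) p q :
  psat e (sol_and p q) <-> psat e p /\ psat e q.
Proof. by case: q => //=; tauto. Qed.

Lemma psat_sol_ex m (e : var -> value m) x b p :
  psat e (sol_ex x b p) <-> exists v, inbase m b v /\ psat (upd e x v) p.
Proof. by case: p => //=; split=> // -[v []]. Qed.

Lemma pwf_sol_or G p q : pwf G p -> pwf G q -> pwf G (sol_or p q).
Proof. by case: p => //=; case: q => //=. Qed.

Lemma pkvars_sol_or p q : pkvars (sol_or p q) = pkvars p ++ pkvars q.
Proof. by case: p => //=; case: q => //= *; rewrite ?cats0. Qed.

(** Used for valuations and, with [u] equal to [G], for environments extending [G]; outside the
    domain of [G], [v] is arbitrary. *)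
Definition agree (A : Type) G (u v : var -> A) :=
  forall z, G z <> None -> v z = u z.

Lemma agree_upd (A : Type) G x b (u v : var -> A) (a : A) :
  agree G u v -> agree (upd G x (Some b)) (upd u x a) (upd v x a).
Proof. by move=> uv z; rewrite /upd; case: eqP => // _ /uv. Qed.

(** A binder new to [G] can be forgotten: overwriting [x] is invisible on the domain of [G]. *)
Lemma agree_updl (A : Type) G x b (u v : var -> A) (a : A) :
  G x = None -> agree (upd G x (Some b)) (upd u x a) v -> agree G u v.
Proof.
move=> Gx uv z Gz; have := uv z; rewrite /upd.
by case: eqP => [zx | _]; [rewrite zx in Gz | apply].
Qed.

(** * Parameters and their instantiation *)

Definition args k := unzip1 (params k).

Lemma inst_id k ys z : z \notin args k -> inst params k ys z = z.
Proof. by rewrite /inst => /negPf ->. Qed.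

Lemma map_inst k ys : uniq (args k) -> size ys = size (args k) ->
  map (inst params k ys) (args k) = ys.
Proof.
move=> uk sz; apply: (@eq_from_nth _ 0); rewrite size_map // => i ik.
rewrite (nth_map 0) // /inst mem_nth // index_uniq //.
by apply: set_nth_default; rewrite sz.
Qed.

(** [inst] moves parameters only, and these lie outside [G]. *)
Lemma agree_inst (A : Type) G k ys (u : var -> A) :
  {in args k, forall x, G x = None} -> agree G u (u \o inst params k ys).
Proof.
move=> Gk z Gz /=; rewrite inst_id //.
by apply/negP => /Gk.
Qed.

Definition arg_types k : seq (option (base L)) := [seq Some xb.2 | xb <- params k].

Lemma size_kapp G k ys :
  map G ys = arg_types k -> size ys = size (args k).
Proof. by move/(congr1 size); rewrite !size_map. Qed.

Lemma kapp_bound G k ys z :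
  map G ys = arg_types k -> z \in ys -> G z <> None.
Proof.
move=> Gys zys Gz.
have : forall t : seq (var * base L), map G ys = [seq Some xb.2 | xb <- t] -> False.
  elim: ys zys {Gys} => //= y ys IH; rewrite inE => /predU1P [<- | /IH zys] [] //= xb t [].
    by rewrite Gz.
  by move=> _ /zys.
by apply; exact: Gys.
Qed.

(** [zip] truncates to the shorter list, hence the hypothesis on sizes. *)
Lemma psat_args_eq m (e : var -> value m) k ys : size ys = size (args k) ->
  psat e (args_eq params k ys) <-> map e (args k) = map e ys.
Proof.
rewrite /args_eq -/(args k); elim: (args k) ys => [|x xs IH] [|y ys] //= [sz].
by rewrite IH //; split=> [[-> ->] | [-> ->]].
Qed.

Lemma pwf_args_eq G k ys :
  map G (args k) = arg_types k -> map G ys = arg_types k ->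
  pwf G (args_eq params k ys).
Proof.
rewrite /args_eq -/(args k) /arg_types.
elim: (params k) (args k) ys => [|b bs IH] [|x xs] [|y ys] //= [Gx Gxs] [Gy Gys].
by split; [exists b.2 | apply: IH].
Qed.

Lemma refinement_args_eq k ys : is_refinement (args_eq params k ys).
Proof. by rewrite /is_refinement /args_eq; elim: (zip _ _) => //= -[]. Qed.

(** * Ranks of refinement variables *)

Fixpoint hkvars c : seq K :=
  match c with
  | CPred p => pkvars p
  | CAnd c1 c2 => hkvars c1 ++ hkvars c2
  | CAll _ _ _ c => hkvars c
  end.

(** Eliminating in an arbitrary order may put refinement variables under disjunctions and
    existentials in hypotheses; normal form is guaranteed to survive in the heads only. *)
Fixpoint head_nnf c : bool :=
  match c with
  | CPred p => nnf_pred p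
  | CAnd c1 c2 => head_nnf c1 && head_nnf c2
  | CAll _ _ _ c => head_nnf c
  end.

(** Expresses by recursion on [c] that [r] increases along [dep c], without the detour through
    [flatten]. *)
Fixpoint ranked (r : K -> nat) c : Prop :=
  match c with
  | CPred _ => True
  | CAnd c1 c2 => ranked r c1 /\ ranked r c2
  | CAll _ _ p c =>
      (forall a b, a \in pkvars p -> b \in hkvars c -> r a < r b) /\ ranked r c
  end.

Lemma nnf_head_nnf c : nnf c -> head_nnf c.
Proof.
by elim: c => //= [c1 IH1 c2 IH2 /andP [/IH1 -> /IH2 ->] | x b p c IH /andP [_ /IH]].
Qed.

(** [flatten] drops only heads [PTrue], in which no refinement variable occurs. *)
Lemma has_hkvars c a :
  a \in hkvars c -> has (fun f => a \in head_kvars f) (Defs.flatten c).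
Proof.
elim: c => [p | c1 IH1 c2 IH2 | x b p c IH] /=.
- by case: p => //= *; rewrite /head_kvars /= orbF.
- by rewrite mem_cat has_cat => /orP [/IH1 | /IH2] ->; rewrite ?orbT.
- by rewrite has_map.
Qed.

Lemma ranked_dep r c : (forall a b, dep c a b -> r a < r b) -> ranked r c.
Proof.
rewrite /dep; elim: c => [p | c1 IH1 c2 IH2 | x b p c IH] //= lt_r.
  by split; [apply: IH1 | apply: IH2] => a b ab; apply: lt_r; rewrite has_cat ab ?orbT.
split=> [a a' ap /has_hkvars | ].
  move=> a'c; apply: lt_r; rewrite has_map.
  by apply: sub_has a'c => f /= a'f; rewrite /body_kvars /= mem_cat ap.
apply: IH => a a' aa'; apply: lt_r; rewrite has_map.
apply: sub_has aa' => f /= /andP [af a'f].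
by rewrite /body_kvars /= mem_cat -/(body_kvars f) af orbT.
Qed.

Lemma psol_nohead k p : k \notin pkvars p -> psol params k p = PFalse L K.
Proof.
elim: p => //= [k' ys | p IHp q IHq].
  by rewrite inE eq_sym => /negPf ->.
by rewrite mem_cat negb_or => /andP [/IHp -> /IHq ->].
Qed.

(** The simplifying connectives make the solution syntactically [PFalse] here, so hypotheses above
    no head occurrence of [k] leave no trace in it. *)
Lemma sol_nohead k c : k \notin hkvars c -> sol params k c = PFalse L K.
Proof.
elim: c => [p | c1 IH1 c2 IH2 | x b p c IH] /=; first exact: psol_nohead.
  by rewrite mem_cat negb_or => /andP [/IH1 -> /IH2 ->].
by move/IH ->.
Qed.

Lemma refinement_psol k p : is_refinement (psol params k p).
Proof.
elim: p => //= [k' ys | p IHp q IHq].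
  by case: eqP => // _; apply: refinement_args_eq.
by rewrite /is_refinement pkvars_sol_or cat_nilP; apply/andP.
Qed.

(** A hypothesis is copied into the solution only if [k] occurs in a head below it, and then
    [ranked] bounds the ranks of its variables. *)
Lemma pkvars_sol r k c a : ranked r c -> a \in pkvars (sol params k c) ->
  r a < r k /\ a \in kvars c.
Proof.
elim: c => [p _ | c1 IH1 c2 IH2 | x b p c IH] /=.
- by rewrite (eqP (refinement_psol k p)).
- rewrite pkvars_sol_or !mem_cat => -[r1 r2] /orP [/(IH1 r1) | /(IH2 r2)] [-> ->];
    by rewrite ?orbT.
case=> lt_r rc; case: (boolP (k \in hkvars c)) => [kc | /sol_nohead -> //].
(* [sol_and] collapses exactly when the inner solution is [PFalse], and [sol_ex] then collapses with
   it. *)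
have -> : forall q q' : predicate L K, pkvars (sol_ex x b (sol_and q q')) =
    if q' is PFalse then [::] else pkvars q ++ pkvars q' by move=> q [].
have: a \in pkvars p ++ pkvars (sol params k c) -> r a < r k /\ a \in pkvars p ++ kvars c.
  rewrite !mem_cat => /orP [ap | /(IH rc) [-> ->]]; last by rewrite orbT.
  by rewrite ap lt_r.
by case: (sol params k c).
Qed.

(** Fuses [scope], [scope_matrix] and [sol] into one recursion, so that proofs reach the scope of
    [k] by induction on [c]. *)
Fixpoint scope_sol k c : predicate L K :=
  match c with
  | CPred _ => sol params k c
  | CAnd c1 c2 =>
      if (k \in kvars c1) && (k \notin kvars c2) then scope_sol k c1
      else if (k \notin kvars c1) && (k \in kvars c2) then scope_sol k c2
      else sol params k c
  | CAll x b p c' => if k \notin pkvars p then scope_sol k c' else sol params k c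
  end.

(** A conjunct without [k] contributes [PFalse], which [sol_or] absorbs. *)
Lemma psol_pscope k p : psol params k (pscope k p) = psol params k p.
Proof.
elim: p => //= p IHp q IHq.
case: ifP => [/andP [_ kq] | _].
  by rewrite IHp (psol_nohead kq); case: (psol _ _ _).
by case: ifP => [/andP [kp _] | //]; rewrite IHq (psol_nohead kp).
Qed.

Lemma sol_scope_matrix k c : sol params k (scope_matrix k (scope k c)) = scope_sol k c.
Proof.
elim: c => [p | c1 IH1 c2 IH2 | x b p c IH] /=; first exact: psol_pscope.
  by do 2 case: ifP => // _.
by case: ifP => kp //=; rewrite kp.
Qed.

Lemma pkvars_scope_sol r k c a : ranked r c -> a \in pkvars (scope_sol k c) ->
  r a < r k /\ a \in kvars c.
Proof.
elim: c => [p | c1 IH1 c2 IH2 | x b p c IH] rc; first exact: pkvars_sol.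
  rewrite /=; case: ifP => _.
    by case: rc => /= r1 _ /(IH1 r1) [-> a1]; rewrite mem_cat a1.
  case: ifP => _; last exact: (pkvars_sol rc).
  by case: rc => /= _ r2 /(IH2 r2) [-> a2]; rewrite mem_cat a2 orbT.
rewrite /=; case: ifP => _; last exact: (pkvars_sol rc).
by case: rc => /= _ r2 /(IH r2) [-> a2]; rewrite mem_cat a2 orbT.
Qed.

(** * Refinement variables left by an elimination *)

Definition single k (t : predicate L K) : assignment L K :=
  fun k' => if k' == k then Some t else None.

Lemma elim1E k c : elim1 params k c = elim_with params (single k (scope_sol k c)) c.
Proof. by rewrite /elim1 /strongest_scoped sol_scope_matrix. Qed.

Lemma pkvars_papply_single k t p a : k \notin pkvars t ->
  a \in pkvars (papply params (single k t) p) ->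
  a != k /\ (a \in pkvars p \/ (k \in pkvars p /\ a \in pkvars t)).
Proof.
move=> kt; elim: p => //= [k' ys | p IHp q IHq | p IHp q IHq].
- rewrite /single !inE; case: eqP => [-> | /eqP k'k] /=.
    rewrite pkvars_psubst => at'; rewrite at' eqxx; split; last by right.
    by apply: contraNneq kt => <-.
  by rewrite inE => /eqP ->; rewrite eqxx k'k; split => //; left.
- by rewrite !mem_cat => /orP [/IHp | /IHq] [-> [-> | [-> ->]]]; rewrite ?orbT; split=> //;
    first [by left | by right].
- by rewrite !mem_cat => /orP [/IHp | /IHq] [-> [-> | [-> ->]]]; rewrite ?orbT; split=> //;
    first [by left | by right].
Qed.

Lemma pkvars_pelim_single k t p : nnf_pred p ->
  pkvars (pelim (single k t) p) = [seq a <- pkvars p | a != k].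
Proof.
elim/nnf_pred_ind => [{}p rp | k' ys | {}p q IHp IHq] /=.
- by rewrite pelim_refinement // (eqP rp).
- by rewrite /single; case: (k' == k).
- by rewrite IHp IHq filter_cat.
Qed.

Lemma hkvars_elim_with k t c : head_nnf c ->
  hkvars (elim_with params (single k t) c) = [seq a <- hkvars c | a != k].
Proof.
elim: c => //= [p | c1 IH1 c2 IH2]; first exact: pkvars_pelim_single.
by case/andP => /IH1 -> /IH2 ->; rewrite filter_cat.
Qed.

Lemma nnf_pred_pelim s p : nnf_pred p -> nnf_pred (pelim s p).
Proof.
elim/nnf_pred_ind => [{}p rp | k' ys | {}p q IHp IHq] /=.
- by rewrite pelim_refinement // nnf_refinement.
- by case: (s k').
- by rewrite IHp.
Qed.

Lemma head_nnf_elim_with s c : head_nnf c -> head_nnf (elim_with params s c).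
Proof.
elim: c => //= [p | c1 IH1 c2 IH2]; first exact: nnf_pred_pelim.
by case/andP => /IH1 -> /IH2 ->.
Qed.

Lemma kvars_elim_with k t c a : head_nnf c -> k \notin pkvars t ->
  {subset pkvars t <= kvars c} ->
  a \in kvars (elim_with params (single k t) c) -> a != k /\ a \in kvars c.
Proof.
move=> nc kt tc.
(* The inclusion of [pkvars t] in [kvars c] is not inherited by the parts of [c], so the induction
   keeps [pkvars t] as a separate alternative. *)
suff: a \in kvars (elim_with params (single k t) c) ->
    a != k /\ (a \in kvars c \/ a \in pkvars t).
  by move=> H /H [-> [-> | /tc ->]].
elim: c nc {tc} => [p | c1 IH1 c2 IH2 | x b p c IH] /=.
- move=> np; rewrite pkvars_pelim_single // mem_filter => /andP [-> ->].
  by split=> //; left.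
- case/andP => n1 n2; rewrite !mem_cat.
  by case/orP => [/(IH1 n1) | /(IH2 n2)] [-> [-> | ->]]; rewrite ?orbT; split=> //;
    first [by left | by right].
- move=> nc; rewrite !mem_cat; case/orP.
    by case/(pkvars_papply_single kt) => -> [-> | [_ ->]]; split=> //;
    first [by left | by right].
  by case/(IH nc) => -> [-> | ->]; rewrite ?orbT; split=> //;
    first [by left | by right].
Qed.

Lemma ranked_elim_with r k t c : head_nnf c -> k \notin pkvars t ->
  (forall a, a \in pkvars t -> r a < r k) ->
  ranked r c -> ranked r (elim_with params (single k t) c).
Proof.
move=> nc kt lt_rt; elim: c nc => //= [c1 IH1 c2 IH2 | x b p c IH].
  by case/andP => n1 n2 [r1 r2]; split; [apply: IH1 | apply: IH2].
move=> nc [lt_r rc]; split; last exact: IH.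
move=> a a' /(pkvars_papply_single kt) [_ ac].
rewrite hkvars_elim_with // mem_filter => /andP [_ a'c].
(* In the second case [a] comes from the solution of [k], and [r a < r k < r a']. *)
by case: ac => [ap | [kp /lt_rt /ltn_trans]]; [apply: lt_r | apply; apply: lt_r].
Qed.

Lemma elim1_ranked r k c : head_nnf c -> ranked r c ->
  [/\ head_nnf (elim1 params k c), ranked r (elim1 params k c)
    & {subset kvars (elim1 params k c) <= [predD1 kvars c & k]}].
Proof.
move=> nc rc; rewrite elim1E.
have kt : k \notin pkvars (scope_sol k c).
  by apply/negP => /(pkvars_scope_sol rc) []; rewrite ltnn.
split.
- exact: head_nnf_elim_with.
- by apply: ranked_elim_with => // a /(pkvars_scope_sol rc) [].
- move=> a ac; have [|ak ac'] := kvars_elim_with nc kt _ ac; last by rewrite inE /= ak.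
  by move=> a' /(pkvars_scope_sol rc) [].
Qed.

Lemma elim_vc r ks c : head_nnf c -> ranked r c -> {subset kvars c <= ks} ->
  is_vc (elim params ks c).
Proof.
elim: ks c => [|k ks IH] c nc rc sub /=.
  by rewrite /is_vc; case: (kvars c) sub => // a s /(_ a); rewrite inE eqxx => /(_ isT).
have [nc' rc' sub'] := elim1_ranked k nc rc.
apply: IH => // a /sub' /andP [/= ak /sub].
by rewrite inE (negPf ak).
Qed.

(** The rank of a vertex counts the vertices from which it is reachable. *)
Lemma acyclic_rank c : acyclic c ->
  exists r : K -> nat, forall a b, dep c a b -> r a < r b.
Proof.
move=> ac; exists (fun a => #|[set x | connect (dep c) x a]|) => a b ab.
apply: proper_card; apply/properP; split.
  apply/subsetP => x; rewrite !inE => xa.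
  exact: connect_trans xa (connect1 ab).
(* [b] reaches itself; if it reached [a], the edge from [a] to [b] would close a cycle. *)
exists b; rewrite !inE //.
apply/negP => /connectP [p bp lp].
by have := ac b p; rewrite /= rcons_path bp -lp ab.
Qed.

(** * Satisfiability is preserved by one elimination *)

Definition override s k (t : predicate L K) : assignment L K :=
  fun k' => if k' == k then Some t else s k'.

(** [t] has no refinement variables, so [s] leaves it alone once it is substituted. *)
Lemma papply_single s k t p : is_refinement t ->
  papply params s (papply params (single k t) p) = papply params (override s k t) p.
Proof.
move=> rt; elim: p => //= [k' ys | p -> q -> | p -> q -> | x b p ->] //.
rewrite /single /override; case: (k' == k) => //=.
by rewrite papply_refinement // /is_refinement pkvars_psubst.
Qed.

Lemma eq_papply s s' p : {in pkvars p, s =1 s'} -> papply params s p = papply params s' p.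
Proof.
elim: p => //= [k ys | p IHp q IHq | p IHp q IHq | x b p IHp] ss'.
- by rewrite ss' ?inE.
- by rewrite IHp ?IHq // => a ap; apply: ss'; rewrite mem_cat ap ?orbT.
- by rewrite IHp ?IHq // => a ap; apply: ss'; rewrite mem_cat ap ?orbT.
- by rewrite IHp.
Qed.

Lemma eq_capply s s' c : {in kvars c, s =1 s'} -> capply params s c = capply params s' c.
Proof.
elim: c => /= [p | c1 IH1 c2 IH2 | x b p c IH] ss'.
- by rewrite (eq_papply ss').
- by rewrite IH1 ?IH2 // => a ap; apply: ss'; rewrite mem_cat ap ?orbT.
- by rewrite (@eq_papply s s') ?IH // => a ap; apply: ss'; rewrite mem_cat ap ?orbT.
Qed.

Lemma papply_id s p : {in pkvars p, forall a, s a = None} -> papply params s p = p.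
Proof.
move=> sN; rewrite (@eq_papply s (fun _ => None)) //.
by elim: p {sN} => //= [p -> q -> | p -> q -> | x b p ->].
Qed.

Lemma pelim_id s p : {in pkvars p, forall a, s a = None} -> pelim s p = p.
Proof.
elim: p => //= [k ys | p IHp q IHq] sN; first by rewrite sN ?inE.
by rewrite IHp ?IHq // => a ap; apply: sN; rewrite mem_cat ap ?orbT.
Qed.

Lemma elim_with_id s c : {in kvars c, forall a, s a = None} -> elim_with params s c = c.
Proof.
elim: c => /= [p | c1 IH1 c2 IH2 | x b p c IH] sN; first by rewrite pelim_id.
  by rewrite IH1 ?IH2 // => a ap; apply: sN; rewrite mem_cat ap ?orbT.
by rewrite papply_id ?IH // => a ap; apply: sN; rewrite mem_cat ap ?orbT.
Qed.

Lemma single_notin k t (s : seq K) : k \notin s -> {in s, forall a, single k t a = None}.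
Proof. by move=> ks a a_s; rewrite /single; case: eqP => // ak; rewrite -ak a_s in ks. Qed.

Lemma override_notin s k t (s' : seq K) : k \notin s' -> {in s', override s k t =1 s}.
Proof. by move=> ks a a_s; rewrite /override; case: eqP => // ak; rewrite -ak a_s in ks. Qed.

(** The variable convention in a form that descends through binders, [G] holding those already
    passed. *)
Definition separate k G c :=
  [/\ uniq (binders c), {in binders c, forall x, G x = None},
      {in args k, forall x, G x = None}
    & {in args k, forall x, x \notin binders c}].

Lemma separate_and k G c1 c2 : separate k G (CAnd c1 c2) ->
  separate k G c1 /\ separate k G c2.
Proof.
case=> /=; rewrite cat_uniq => /and3P [u1 _ u2] Gb Gk kb.
split; split=> // x xc; try (by apply: Gb; rewrite mem_cat xc ?orbT).
  by have := kb x xc; rewrite mem_cat negb_or => /andP [].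
by have := kb x xc; rewrite mem_cat negb_or => /andP [].
Qed.

Lemma separate_all k G x b p c : separate k G (CAll x b p c) ->
  [/\ separate k (upd G x (Some b)) c, G x = None & x \notin args k].
Proof.
case=> /= /andP [xc uc] Gb Gk kb.
have xk : x \notin args k by apply/negP => /kb; rewrite inE eqxx.
split=> //; last by apply: Gb; rewrite inE eqxx.
split=> // z zc; rewrite /upd.
- case: eqP => [zx | _]; first by rewrite -zx zc in xc.
  by apply: Gb; rewrite inE zc orbT.
- by case: eqP => [zx | _]; [rewrite -zx zc in xk | apply: Gk].
- by have := kb z zc; rewrite inE negb_or => /andP [].
Qed.

Lemma map_upd_notin (A : Type) (u : var -> A) x (a : A) (s : seq var) :
  x \notin s -> map (upd u x a) s = map u s.
Proof.
move=> xs; apply/eq_in_map => z zs; rewrite /upd.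
by case: eqP => // zx; rewrite -zx zs in xs.
Qed.

(** Holds of the variable eliminated first in a dependency order; its solution then copies
    refinements only. *)
Fixpoint nodep k c : Prop :=
  match c with
  | CPred _ => True
  | CAnd c1 c2 => nodep k c1 /\ nodep k c2
  | CAll _ _ p c => (k \in hkvars c -> is_refinement p) /\ nodep k c
  end.

Lemma nodep_ranked r k c : ranked r c -> {in kvars c, forall a, r k <= r a} -> nodep k c.
Proof.
elim: c => //= [c1 IH1 c2 IH2 [r1 r2] | x b p c IH [lt_r rc]] le_r.
  by split; [apply: IH1 | apply: IH2] => // a ac; apply: le_r; rewrite mem_cat ac ?orbT.
split; last by apply: IH => // a ac; apply: le_r; rewrite mem_cat ac ?orbT.
move=> kc; rewrite /is_refinement; case E: (pkvars p) => [//|a l].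
have ap : a \in pkvars p by rewrite E inE eqxx.
have := lt_r a k ap kc; rewrite ltnNge le_r //.
by rewrite mem_cat ap.
Qed.

(* Only the hypotheses above a head occurrence of [k] are copied into [sol k c]. *)
Fixpoint path_wf k G c : Prop :=
  match c with
  | CPred _ => True
  | CAnd c1 c2 => path_wf k G c1 /\ path_wf k G c2
  | CAll x b p c =>
      (k \in hkvars c -> pwf (upd G x (Some b)) p) /\ path_wf k (upd G x (Some b)) c
  end.

(** The hypotheses that [path_wf] concerns are refinements by [nodep], hence unchanged by [s]. *)
Lemma path_wf_capply s k G c : nodep k c -> cwf G (capply params s c) -> path_wf k G c.
Proof.
elim: c G => //= [c1 IH1 c2 IH2 G [n1 n2] [w1 w2] | x b p c IH G [rp nc] [wp wc]].
  by split; [apply: IH1 | apply: IH2].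
split; last exact: IH.
by move=> /rp rp'; rewrite papply_refinement in wp.
Qed.

Lemma path_wf_elim s k t G c : nodep k c ->
  cwf G (capply params s (elim_with params (single k t) c)) -> path_wf k G c.
Proof.
elim: c G => //= [c1 IH1 c2 IH2 G [n1 n2] [w1 w2] | x b p c IH G [rp nc] [wp wc]].
  by split; [apply: IH1 | apply: IH2].
split; last exact: IH.
by move=> /rp rp'; rewrite !papply_refinement in wp.
Qed.

(** [G'] stands for [G] extended by the parameters of [k], such as the environment
    [G \o inst params k ys] at an occurrence of [k]. *)
Lemma pwf_sol k G G' c : separate k G c -> kapp params G c -> path_wf k G c ->
  agree G G G' -> map G' (args k) = arg_types k -> pwf G' (sol params k c).
Proof.
elim: c G G' => [p | c1 IH1 c2 IH2 | x b p c IH] G G' /=.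
- move=> _ ap _ GG' Gk; elim: p ap => //= [k' ys | p IHp q IHq].
    case: eqP => // -> Gys; apply: pwf_args_eq => //.
    rewrite -[RHS]Gys; apply/eq_in_map => z zys.
    by apply: GG'; apply: kapp_bound Gys zys.
  by case=> /IHp wp /IHq wq; apply: pwf_sol_or.
- move=> /separate_and [s1 s2] [a1 a2] [w1 w2] GG' Gk.
  by apply: pwf_sol_or; [apply: IH1 w1 _ _ | apply: IH2 w2 _ _].
move=> /separate_all [sc Gx xk] [_ ac] [wp wc] GG' Gk.
case: (boolP (k \in hkvars c)) => [kc | /sol_nohead -> //].
have {}wp : pwf (upd G' x (Some b)) p.
  apply: pwf_ext (wp kc) => z /(pwf_fv (wp kc)) Gz.
  by rewrite (agree_upd (b := b) _ GG').
have : pwf (upd G' x (Some b)) (sol params k c).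
  apply: IH sc ac wc _ _; first exact: agree_upd.
  by rewrite map_upd_notin.
by case: (sol params k c).
Qed.

(** * A constraint compared with its elimination *)

Section Uniq.

Hypothesis uniq_args : forall k, uniq (args k).

Lemma map_comp_inst (A : Type) (u : var -> A) G k ys :
  map G ys = arg_types k -> map (u \o inst params k ys) (args k) = map u ys.
Proof. by move=> /size_kapp sz; rewrite map_comp map_inst. Qed.

Lemma agree_map (A : Type) (u v : var -> A) G k ys :
  map G ys = arg_types k -> agree G u v -> map v ys = map u ys.
Proof.
by move=> Gys uv; apply/eq_in_map => z zys; apply: uv; apply: kapp_bound Gys zys.
Qed.

(* The witnesses of [sol k c] single out a path to some head [k(ys)], at which [csat]
   provides [q]; this [q] is insensitive to the values of the binders on the path. *)
Lemma sol_strongest s k q G m (e e' : var -> value m) c :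
  s k = Some q -> separate k G c -> kapp params G c -> path_wf k G c ->
  (forall z, z \in pfv q -> z \notin args k -> G z <> None) ->
  csat e (capply params s c) -> agree G e e' -> psat e' (sol params k c) -> psat e' q.
Proof.
move=> sk; elim: c G e e' => [p | c1 IH1 c2 IH2 | x b p c IH] G e e' /=.
- move=> [_ _ Gk _] ap _ Gq ep ee'; elim: p ap ep => //= [k' ys | p IHp q' IHq].
    case: eqP => // -> Gys; rewrite sk => /psat_psubst eq.
    rewrite psat_args_eq ?(size_kapp Gys) // (agree_map Gys ee').
    rewrite -(map_comp_inst e Gys) => /eq_in_map e'e.
    apply: psat_ext eq => z zq; case: (boolP (z \in args k)) => [/e'e // | zk].
    (* A variable of [q] that is no parameter is bound in [G] and left alone by [inst]. *)
    by rewrite (ee' _ (Gq z zq zk)) /= inst_id.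
  by case=> ap aq [ep eq]; rewrite psat_sol_or => -[/(IHp ap ep) | /(IHq aq eq)].
- move=> /separate_and [s1 s2] [a1 a2] [w1 w2] Gq [e1 e2] ee'.
  by rewrite psat_sol_or => -[];
    [apply: IH1 s1 a1 w1 Gq e1 ee' | apply: IH2 s2 a2 w2 Gq e2 ee'].
move=> /separate_all [sc Gx xk] [_ ac] [wp wc] Gq ec ee'.
case: (boolP (k \in hkvars c)) => [kc | /sol_nohead -> //].
rewrite psat_sol_ex => -[v [bv]]; rewrite psat_sol_and => -[e'p e'c].
have ee'v := agree_upd (b := b) (x := x) v ee'.
have rp := pwf_refinement (wp kc).
have ep : psat (upd e x v) (papply params s p).
  rewrite papply_refinement //; apply: psat_ext e'p => z /(pwf_fv (wp kc)).
  by move/ee'v.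
have : psat (upd e' x v) q.
  apply: (IH _ _ _ sc ac wc _ (ec v bv ep) ee'v e'c) => z zq zk.
  by rewrite /upd; case: eqP => // _; apply: Gq.
(* [x] is neither a parameter of [k] nor bound in [G], so it is not free in [q]. *)
apply: psat_ext => z zq; rewrite /upd; case: eqP => // zx.
by have := Gq z zq; rewrite zx => /(_ xk).
Qed.

Lemma pwf_weaken s k t G p : nnf_pred p -> pkapp params G p ->
  {in args k, forall x, G x = None} ->
  (forall G', agree G G G' -> map G' (args k) = arg_types k -> pwf G' t) ->
  pwf G (papply params s p) -> pwf G (papply params (override s k t) p).
Proof.
move=> np ap Gk wt; elim/nnf_pred_ind: p / np ap =>
  [p rp _ | k' ys Gys | p q IHp IHq [ap aq]] /=.
- by rewrite !papply_refinement.
- rewrite /override; case: eqP Gys => [-> Gys _ | //].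
  by apply/pwf_psubst; apply: wt; [apply: agree_inst | rewrite (map_comp_inst _ Gys)].
- by case=> /(IHp ap) ? /(IHq aq) ?.
Qed.

(** Predicates allowed by [nnf_pred] are monotone in [k], and instantiation yields a valuation that
    agrees with [e] on [G], where [t] implies [q]. *)
Lemma psat_weaken s k q t G m (e : var -> value m) p :
  nnf_pred p -> s k = Some q -> {in args k, forall x, G x = None} ->
  (forall e', agree G e e' -> psat e' t -> psat e' q) ->
  psat e (papply params (override s k t) p) -> psat e (papply params s p).
Proof.
move=> np sk Gk tq; elim/nnf_pred_ind: p / np => [p rp | k' ys | p p' IHp IHp'] /=.
- by rewrite !papply_refinement.
- rewrite /override; case: eqP => [-> | //]; rewrite sk.
  by move=> /psat_psubst et; apply/psat_psubst; apply: tq et; apply: agree_inst.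
- by case=> /IHp ? /IHp' ?.
Qed.

Lemma cwf_elim s k t G c : is_refinement t -> nnf c -> separate k G c -> kapp params G c ->
  (forall G', agree G G G' -> map G' (args k) = arg_types k -> pwf G' t) ->
  cwf G (capply params s c) -> cwf G (capply params s (elim_with params (single k t) c)).
Proof.
move=> rt; elim: c G => [p | c1 IH1 c2 IH2 | x b p c IH] G /=.
- move=> np _ _ _; elim/nnf_pred_ind: p / np => [p rp | k' ys | p q IHp IHq] /=.
  + by rewrite pelim_refinement.
  + by rewrite /single; case: eqP.
  + by case=> /IHp ? /IHq ?.
- move=> /andP [n1 n2] /separate_and [s1 s2] [a1 a2] wt [w1 w2].
  by split; [apply: IH1 | apply: IH2].
move=> /andP [np nc] /separate_all [sc Gx xk] [ap ac] wt [wp wc].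
have wt' G' : agree (upd G x (Some b)) (upd G x (Some b)) G' ->
    map G' (args k) = arg_types k -> pwf G' t.
  by move=> GG'; apply: wt; apply: agree_updl Gx GG'.
split; last exact: IH.
by rewrite papply_single //; apply: (pwf_weaken np ap _ wt' wp); case: sc.
Qed.

(** Heads [k(ys)] become true and hypotheses stronger. Since [t] implies [q] under all valuations
    agreeing on [G], the implication persists below binders. *)
Lemma csat_elim s k q t G m (e : var -> value m) c :
  is_refinement t -> nnf c -> s k = Some q -> separate k G c ->
  (forall e', agree G e e' -> psat e' t -> psat e' q) ->
  csat e (capply params s c) ->
  csat e (capply params s (elim_with params (single k t) c)).
Proof.
move=> rt nc sk; elim: c G e nc => [p | c1 IH1 c2 IH2 | x b p c IH] G e /=.
- move=> np _ _; elim/nnf_pred_ind: p / np => [p rp | k' ys | p p' IHp IHp'] /=.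
  + by rewrite pelim_refinement.
  + by rewrite /single; case: eqP.
  + by case=> /IHp ? /IHp' ?.
- move=> /andP [n1 n2] /separate_and [s1 s2] tq [e1 e2].
  by split; [apply: IH1 s1 tq e1 | apply: IH2 s2 tq e2].
move=> /andP [np nc] /separate_all [sc Gx xk] tq ec v bv.
have tq' e' : agree (upd G x (Some b)) (upd e x v) e' -> psat e' t -> psat e' q.
  by move=> ee'; apply: tq; apply: agree_updl Gx ee'.
rewrite papply_single // => ep; apply: (IH _ _ _ sc tq') => //.
by apply: ec => //; apply: (psat_weaken np sk _ tq' ep); case: sc.
Qed.

Lemma cwf_override s k t G c : is_refinement t -> nnf c -> separate k G c -> kapp params G c ->
  (forall G', agree G G G' -> map G' (args k) = arg_types k -> pwf G' t) ->
  cwf G (capply params s (elim_with params (single k t) c)) ->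
  cwf G (capply params (override s k t) c).
Proof.
move=> rt; elim: c G => [p | c1 IH1 c2 IH2 | x b p c IH] G /=.
- move=> np [_ _ Gk _] + wt; elim/nnf_pred_ind: p / np => [p rp | k' ys | p q IHp IHq] /=.
  + by rewrite pelim_refinement // !papply_refinement.
  + rewrite /single /override; case: eqP => [-> Gys _ | //].
    by apply/pwf_psubst; apply: wt; [apply: agree_inst | rewrite (map_comp_inst _ Gys)].
  + by case=> ap aq [/(IHp ap) ? /(IHq aq) ?].
- move=> /andP [n1 n2] /separate_and [s1 s2] [a1 a2] wt [w1 w2].
  by split; [apply: IH1 | apply: IH2].
move=> /andP [np nc] /separate_all [sc Gx xk] [ap ac] wt.
rewrite papply_single // => -[wp wc]; split=> //; apply: IH => // G' GG'.
by apply: wt; apply: agree_updl Gx GG'.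
Qed.

(** On the path taken, the solution of a part of [c] implies that of [c]. So the assumption on [t]
    descends to each head [k(ys)], where only the equations between parameters and [ys] remain. *)
Lemma csat_override s k t G m (e : var -> value m) c :
  is_refinement t -> nnf c -> separate k G c -> kapp params G c -> path_wf k G c ->
  (forall e', agree G e e' -> psat e' (sol params k c) -> psat e' t) ->
  csat e (capply params s (elim_with params (single k t) c)) ->
  csat e (capply params (override s k t) c).
Proof.
move=> rt; elim: c G e => [p | c1 IH1 c2 IH2 | x b p c IH] G e /=.
- move=> np [_ _ Gk _] + _; elim/nnf_pred_ind: p / np => [p rp | k' ys | p q IHp IHq] /=.
  + by rewrite pelim_refinement // !papply_refinement.
  + rewrite /single /override; case: eqP => [-> Gys et _ | //].
    have ee' : agree G e (e \o inst params k ys) by apply: agree_inst.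
    (* Instantiation gives the parameters the values of [ys], and does not move [ys] themselves,
       which are bound in [G]. *)
    apply/psat_psubst; apply: et => //; rewrite psat_args_eq ?(size_kapp Gys) //.
    by rewrite (map_comp_inst e Gys) (agree_map Gys ee').
  + case=> ap aq et [ep eq]; split; [apply: IHp ap _ ep | apply: IHq aq _ eq] => e' ee' e'p.
      by apply: et => //; rewrite psat_sol_or; left.
    by apply: et => //; rewrite psat_sol_or; right.
- move=> /andP [n1 n2] /separate_and [s1 s2] [a1 a2] [w1 w2] et [e1 e2].
  split; [apply: IH1 s1 a1 w1 _ e1 | apply: IH2 s2 a2 w2 _ e2] => // e' ee' e'c.
    by apply: et => //; rewrite psat_sol_or; left.
  by apply: et => //; rewrite psat_sol_or; right.
move=> /andP [np nc] /separate_all [sc Gx xk] [ap ac] [wp wc] et ec v bv.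
rewrite -papply_single // => ep; apply: IH sc ac wc _ (ec v bv ep) => // e' ee' e'c.
apply: et; first exact: agree_updl Gx ee'.
case: (boolP (k \in hkvars c)) => [kc | kc]; last by move: e'c; rewrite sol_nohead.
(* The witness is the value of the binder on the current path, which [e'] already has at [x]. *)
have e'x : e' x = v by rewrite ee' /upd eqxx.
have e'E z : upd e' x v z = e' z by rewrite /upd; case: eqP => // ->.
rewrite psat_sol_ex; exists v; split=> //; rewrite psat_sol_and; split.
  have rp := pwf_refinement (wp kc); move: ep; rewrite !papply_refinement //.
  by apply: psat_ext => z /(pwf_fv (wp kc)) Gz; rewrite e'E ee'.
by apply: psat_ext e'c => z _; rewrite e'E.
Qed.

(** * Descent to the scope of a refinement variable *)

Lemma pwf_papply_occ s k q G p : nnf_pred p -> s k = Some q -> k \in pkvars p ->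
  pwf G (papply params s p) -> exists ys, pwf (G \o inst params k ys) q.
Proof.
move=> np sk; elim/nnf_pred_ind: p / np => [p rp | k' ys | p p' IHp IHp'] /=.
- by rewrite (eqP rp).
- by rewrite inE => /eqP <-; rewrite sk => /pwf_psubst; exists ys.
- by rewrite mem_cat => /orP [/IHp + [] | /IHp' + []] => H ? ?; apply: H.
Qed.

(** Instantiation renames parameters only, so any other variable of [q] must be captured wherever
    [k] occurs. *)
Lemma cwf_occ s k q G c z : nnf c -> s k = Some q -> k \in kvars c ->
  cwf G (capply params s c) -> z \in pfv q -> z \notin args k ->
  G z <> None \/ z \in binders c.
Proof.
move=> nc sk + + zq zk; elim: c G nc => [p | c1 IH1 c2 IH2 | x b p c IH] G /=.
- move=> np kp /(pwf_papply_occ np sk kp) [ys /pwf_fv /(_ zq)] /=.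
  by rewrite inst_id //; left.
- case/andP => n1 n2; rewrite !mem_cat => /orP [k1 [w1 _] | k2 [_ w2]].
    by case: (IH1 G n1 k1 w1) => [|->]; [left | right].
  by case: (IH2 G n2 k2 w2) => [|->]; [left | rewrite orbT; right].
case/andP => np nc; rewrite mem_cat inE => kpc [wp wc].
have : upd G x (Some b) z <> None \/ z \in binders c.
  case/orP: kpc => [kp | kc]; last exact: IH.
  have [ys /pwf_fv /(_ zq)] := pwf_papply_occ np sk kp wp.
  by rewrite /= inst_id //; left.
rewrite /upd; case: eqP => [_ _ | _ [Gz | ->]]; [by right | by left | by right].
Qed.

Lemma elim1_complete s k q G c : nnf c -> separate k G c -> kapp params G c ->
  nodep k c -> s k = Some q -> is_refinement (scope_sol k c) ->
  cwf G (capply params s c) ->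
  let c' := elim_with params (single k (scope_sol k c)) c in
  cwf G (capply params s c') /\
  forall m (e : var -> value m), csat e (capply params s c) -> csat e (capply params s c').
Proof.
move=> + + + + sk.
(* The case where the scope of [k] ends. Without a head occurrence the solution is [PFalse] and
   implies anything, hence the guard [k \in hkvars d]. *)
have base G' d : nnf d -> separate k G' d -> kapp params G' d -> nodep k d ->
    is_refinement (sol params k d) -> cwf G' (capply params s d) ->
    (forall z, z \in pfv q -> z \notin args k -> k \in hkvars d -> G' z <> None) ->
    let d' := elim_with params (single k (sol params k d)) d in
    cwf G' (capply params s d') /\
    forall m (e : var -> value m), csat e (capply params s d) -> csat e (capply params s d').
  move=> nd sd ad dd rd wd Gq; have wp := path_wf_capply dd wd; split.
    by apply: cwf_elim wd => // G'' GG''; apply: pwf_sol GG''.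
  move=> m e ed; apply: (csat_elim (q := q) _ _ _ sd) => // e' ee' e'd.
  case: (boolP (k \in hkvars d)) => kd; last by move: e'd; rewrite sol_nohead.
  by apply: (sol_strongest sk sd ad wp _ ed ee' e'd) => z zq zk; apply: Gq.
elim: c G => [p | c1 IH1 c2 IH2 | x b p c IH] G nc sc ac dc rc wc.
(* A bare head has no binders, so [G] must bind [z]. *)
- apply: base => // z zq zk kp.
  by case: (cwf_occ nc sk kp wc zq zk).
- case: (boolP (k \in kvars c1)) (boolP (k \in kvars c2)) => k1 [] k2.
  + have -> : scope_sol k (CAnd c1 c2) = sol params k (CAnd c1 c2) by rewrite /= k1 k2.
    apply: base => // [|z zq zk _]; first by move: rc; rewrite /= k1 k2.
    case: sc wc nc => /=; rewrite cat_uniq => /and3P [_ /hasPn dis _] _ _ _.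
    case=> w1 w2 /andP [n1 n2].
    (* Otherwise [z] would be a binder of both conjuncts, whose binders are disjoint. *)
    case: (cwf_occ n1 sk k1 w1 zq zk) => // z1.
    case: (cwf_occ n2 sk k2 w2 zq zk) => // /dis; by rewrite /= z1.
  + move: rc; rewrite /= k1 k2 /= => rc.
    move: sc wc nc ac dc => /separate_and [s1 s2] [w1 w2] /andP [n1 n2] [a1 a2] [d1 d2].
    have [w1' e1'] := IH1 G n1 s1 a1 d1 rc w1.
    rewrite (@elim_with_id _ c2); last exact: single_notin.
    by split=> // m e [e1 e2]; split=> //; apply: e1'.
  + move: rc; rewrite /= (negPf k1) k2 /= => rc.
    move: sc wc nc ac dc => /separate_and [s1 s2] [w1 w2] /andP [n1 n2] [a1 a2] [d1 d2].
    have [w2' e2'] := IH2 G n2 s2 a2 d2 rc w2.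
    rewrite (@elim_with_id _ c1); last exact: single_notin.
    by split=> // m e [e1 e2]; split=> //; apply: e2'.
  + rewrite elim_with_id //; apply: single_notin.
    by rewrite mem_cat negb_or k1.
- case: (boolP (k \in pkvars p)) => kp.
    have -> : scope_sol k (CAll x b p c) = sol params k (CAll x b p c) by rewrite /= kp.
    (* A head occurrence of [k] below would make [p] a refinement by [nodep], against [kp]. *)
    apply: base => // [|z _ _ /= kc]; first by move: rc; rewrite /= kp.
    by move: kp; case: dc => /(_ kc) /eqP ->.
  move: rc; rewrite /= kp => rc.
  move: sc wc nc ac dc => /separate_all [sc Gx xk] [wp wc] /andP [np nc] [ap ac] [_ dc].
  have [wc' ec'] := IH _ nc sc ac dc rc wc.
  rewrite (@papply_id (single _ _)); last exact: single_notin.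
  by split=> // m e ec v bv ep; apply: ec'; apply: ec.
Qed.

(** Descends as in [elim1_complete]; outside the scope of [k], [override] agrees with [s] because
    [k] does not occur there. *)
Lemma elim1_sound s k G c : nnf c -> separate k G c -> kapp params G c ->
  nodep k c -> is_refinement (scope_sol k c) ->
  let t := scope_sol k c in
  let c' := elim_with params (single k t) c in
  cwf G (capply params s c') ->
  cwf G (capply params (override s k t) c) /\
  forall m (e : var -> value m),
    csat e (capply params s c') -> csat e (capply params (override s k t) c).
Proof.
have base G' d : nnf d -> separate k G' d -> kapp params G' d -> nodep k d ->
    is_refinement (sol params k d) ->
    let t := sol params k d in
    let d' := elim_with params (single k t) d in
    cwf G' (capply params s d') ->
    cwf G' (capply params (override s k t) d) /\
    forall m (e : var -> value m),
      csat e (capply params s d') -> csat e (capply params (override s k t) d).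
  move=> nd sd ad dd rd t d' wd'; have wp := path_wf_elim dd wd'; split.
    by apply: cwf_override wd' => // G'' GG''; apply: pwf_sol GG''.
  by move=> m e; apply: (csat_override rd nd sd ad wp).
elim: c G => [p | c1 IH1 c2 IH2 | x b p c IH] G nc sc ac dc rc.
- exact: base.
- case: (boolP (k \in kvars c1)) (boolP (k \in kvars c2)) => k1 [] k2.
  + have E : scope_sol k (CAnd c1 c2) = sol params k (CAnd c1 c2) by rewrite /= k1 k2.
    by rewrite E in rc *; apply: base.
  + move: rc; rewrite /= k1 k2 /= => rc.
    move: sc nc ac dc => /separate_and [s1 s2] /andP [n1 n2] [a1 a2] [d1 d2].
    rewrite (@elim_with_id _ c2); last exact: single_notin.
    rewrite (@eq_capply (override _ _ _) s c2); last exact: override_notin.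
    case=> w1 w2; have [w1' e1'] := IH1 G n1 s1 a1 d1 rc w1.
    by split=> // m e [e1 e2]; split=> //; apply: e1'.
  + move: rc; rewrite /= (negPf k1) k2 /= => rc.
    move: sc nc ac dc => /separate_and [s1 s2] /andP [n1 n2] [a1 a2] [d1 d2].
    rewrite (@elim_with_id _ c1); last exact: single_notin.
    rewrite (@eq_capply (override _ _ _) s c1); last exact: override_notin.
    case=> w1 w2; have [w2' e2'] := IH2 G n2 s2 a2 d2 rc w2.
    by split=> // m e [e1 e2]; split=> //; apply: e2'.
  + have kc : k \notin kvars (CAnd c1 c2) by rewrite mem_cat negb_or k1.
    move=> t c'; rewrite /c' elim_with_id; last exact: single_notin.
    by rewrite (@eq_capply (override _ _ _) s) //; apply: override_notin.
- case: (boolP (k \in pkvars p)) => kp.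
    have E : scope_sol k (CAll x b p c) = sol params k (CAll x b p c) by rewrite /= kp.
    by rewrite E in rc *; apply: base.
  move: rc; rewrite /= kp => rc.
  move: sc nc ac dc => /separate_all [sc Gx xk] /andP [np nc] [ap ac] [_ dc].
  rewrite (@papply_id (single _ _)); last exact: single_notin.
  rewrite (@eq_papply (override _ _ _) s p); last exact: override_notin.
  case=> wp wc; have [wc' ec'] := IH _ nc sc ac dc rc wc.
  by split=> // m e ec v bv ep; apply: ec'; apply: ec.
Qed.

(** * Verification conditions and domains of assignments *)

Lemma is_refinement_papply s p : total_assignment s ->
  is_refinement (papply params s p) = all (fun a => isSome (s a)) (pkvars p).
Proof.
rewrite /is_refinement => ts; elim: p => //= [k ys | p IHp q IHq | p IHp q IHq].
- by case E: (s k) => [q|] //=; rewrite pkvars_psubst (eqP (ts _ _ E)).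
- by rewrite cat_nilP IHp IHq all_cat.
- by rewrite cat_nilP IHp IHq all_cat.
Qed.

(** A total assignment introduces no refinement variables, so only its domain counts. *)
Lemma is_vc_capply s c : total_assignment s ->
  is_vc (capply params s c) <-> all (fun a => isSome (s a)) (kvars c).
Proof.
rewrite /is_vc => ts.
suff -> : all (fun a => isSome (s a)) (kvars c) = (kvars (capply params s c) == [::]).
  exact: rwP eqP.
elim: c => /= [p | c1 IH1 c2 IH2 | x b p c IH].
- by rewrite -is_refinement_papply.
- by rewrite all_cat cat_nilP IH1 IH2.
- by rewrite all_cat cat_nilP IH -is_refinement_papply.
Qed.

Lemma total_override s k t :
  total_assignment s -> is_refinement t -> total_assignment (override s k t).
Proof. by move=> ts rt a p; rewrite /override; case: eqP => [_ [<-] | _ /ts]. Qed.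

Lemma pkvars_papply k t p : is_refinement t ->
  pkvars (papply params (single k t) p) = [seq a <- pkvars p | a != k].
Proof.
move=> rt; elim: p => //= [k' ys | p IHp q IHq | p IHp q IHq].
- by rewrite /single; case: eqP => //= _; rewrite pkvars_psubst (eqP rt).
- by rewrite IHp IHq filter_cat.
- by rewrite IHp IHq filter_cat.
Qed.

Lemma kvars_elim k t c : nnf c -> is_refinement t ->
  kvars (elim_with params (single k t) c) = [seq a <- kvars c | a != k].
Proof.
move=> + rt; elim: c => /= [p | c1 IH1 c2 IH2 | x b p c IH].
- exact: pkvars_pelim_single.
- by case/andP => /IH1 -> /IH2 ->; rewrite filter_cat.
- by case/andP => _ /IH ->; rewrite pkvars_papply // filter_cat.
Qed.

Lemma elim1_satisfiable k c : nnf c -> separate k (empty_env L) c ->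
  kapp params (empty_env L) c -> nodep k c -> is_refinement (scope_sol k c) ->
  satisfiable params (elim1 params k c) <-> satisfiable params c.
Proof.
move=> nc sc ac dc rc; rewrite elim1E; split=> -[s [ts vs ws es]].
  have [w e] := elim1_sound nc sc ac dc rc ws.
  have ts' := total_override (k := k) ts rc.
  exists (override s k (scope_sol k c)); split=> //; last by move=> m e'; apply: e.
  apply/is_vc_capply => //; apply/allP => a ac'; rewrite /override; case: eqP => // /eqP ak.
  move/is_vc_capply: vs => /(_ ts) /allP; apply.
  by rewrite kvars_elim // mem_filter ak.
(* If [k] does not occur, [s] may be undefined at [k], but the elimination changes nothing. *)
case: (boolP (k \in kvars c)) => kc; last first.
  by rewrite elim_with_id; [exists s | apply: single_notin].
have /allP all_s := (is_vc_capply c ts).1 vs.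
case sk: (s k) (all_s k kc) => [q|//] _.
have [w e] := elim1_complete nc sc ac dc sk rc ws.
exists s; split=> //; last by move=> m e'; apply: e.
apply/is_vc_capply => //; apply/allP => a; rewrite kvars_elim // mem_filter.
by case/andP => _ /all_s.
Qed.

End Uniq.

(** * Iterated elimination in a dependency order *)

Lemma nnf_pred_papply k t p : is_refinement t -> nnf_pred p ->
  nnf_pred (papply params (single k t) p).
Proof.
move=> rt; elim/nnf_pred_ind => [{}p rp | k' ys | {}p q IHp IHq] /=.
- by rewrite papply_refinement // nnf_refinement.
- rewrite /single; case: eqP => //= _.
  by rewrite nnf_refinement // /is_refinement pkvars_psubst.
- by rewrite IHp.
Qed.

Lemma nnf_elim_with k t c : is_refinement t -> nnf c ->
  nnf (elim_with params (single k t) c).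
Proof.
move=> rt; elim: c => /= [p | c1 IH1 c2 IH2 | x b p c IH].
- exact: nnf_pred_pelim.
- by case/andP => /IH1 -> /IH2 ->.
- by case/andP => np /IH ->; rewrite nnf_pred_papply.
Qed.

Lemma pkapp_papply k t G p : is_refinement t -> pkapp params G p ->
  pkapp params G (papply params (single k t) p).
Proof.
move=> rt; elim: p G => //= [k' ys | p IHp q IHq | p IHp q IHq | x b p IHp] G.
- rewrite /single; case: eqP => //= _ _.
  by apply: pkapp_refinement; rewrite /is_refinement pkvars_psubst.
- by case=> /IHp ? /IHq ?.
- by case=> /IHp ? /IHq ?.
- exact: IHp.
Qed.

Lemma kapp_elim_with k t G c : is_refinement t -> kapp params G c ->
  kapp params G (elim_with params (single k t) c).
Proof.
move=> rt; elim: c G => /= [p | c1 IH1 c2 IH2 | x b p c IH] G.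
- elim: p => //= [k' ys | p IHp q IHq]; first by rewrite /single; case: eqP.
  by case=> /IHp ? /IHq ?.
- by case=> /IH1 ? /IH2 ?.
- by case=> ap /IH ac; split=> //; apply: pkapp_papply.
Qed.

Lemma binders_elim_with s c : binders (elim_with params s c) = binders c.
Proof. by elim: c => //= [c1 -> c2 -> | x b p c ->]. Qed.

Lemma elim_satisfiable r ks c : nnf c -> kapp params (empty_env L) c ->
  distinct_names params c -> ranked r c -> {subset kvars c <= ks} ->
  pairwise (fun a b => r a <= r b) ks ->
  satisfiable params (elim params ks c) <-> satisfiable params c.
Proof.
elim: ks c => //= k ks IH c nc ac names rc sub /andP [/allP le_rk le_r].
(* The list is sorted by rank, so its first element is minimal among the variables of [c]. *)
have min_k : {in kvars c, forall a, r k <= r a}.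
  by move=> a /sub; rewrite inE => /predU1P [-> // | /le_rk].
have tc : is_refinement (scope_sol k c).
  rewrite /is_refinement; case E: (pkvars _) => [//|a l].
  have [] := @pkvars_scope_sol r k c a rc; first by rewrite E inE eqxx.
  by move=> + /min_k; rewrite ltnNge => /negPf ->.
have [_ rc' sub'] := elim1_ranked k (nnf_head_nnf nc) rc.
have -> : satisfiable params (elim params ks (elim1 params k c)) <->
    satisfiable params (elim1 params k c).
  apply: IH => //; rewrite ?elim1E.
  - exact: nnf_elim_with.
  - exact: kapp_elim_with.
  - by rewrite /distinct_names binders_elim_with.
  - rewrite -elim1E => a /sub' /andP [/= ak /sub].
    by rewrite inE (negPf ak).
apply: elim1_satisfiable => //; last exact: nodep_ranked rc min_k.
  by move=> k'; case: names => _ /(_ k') [].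
by case: names => ub /(_ k) [_ kb]; split.
Qed.

End Predicates.

Theorem corollary5p11 (L : logic) (K : finType)
    (params : K -> seq (var * base L)) (c : constraint L K) (ks : seq K)
    (c_nnf : nnf c)
    (c_app : kapp params (empty_env L) c)
    (c_names : distinct_names params c)
    (c_acyclic : acyclic c)
    (ks_all : perm_eq ks (enum K)) :
  let c' := elim params ks c in
  is_vc c' /\
  (dependency_order c ks ->
     (satisfiable params c' <-> satisfiable params c)).
Proof.
have sub : {subset kvars c <= ks}.
  by move=> k _; rewrite (perm_mem ks_all) mem_enum.
split=> [|ord].
  (* For the first claim the rank comes from acyclicity, whatever the order of [ks]. *)
  have [r /ranked_dep rc] := acyclic_rank c_acyclic.
  exact: elim_vc (nnf_head_nnf c_nnf) rc sub.
(* For the second claim the position in [ks] serves as rank; [ks] is sorted by it because it has no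
   duplicates. *)
apply: (@elim_satisfiable _ _ _ (index^~ ks)) => //; first exact: ranked_dep.
have uks : uniq ks by rewrite (perm_uniq ks_all) enum_uniq.
case: (ks) uks => // k0 l uks; apply/(pairwiseP k0) => i j il jl ij.
by rewrite !index_uniq // ltnW.
Qed.
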